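(* Let $p$ be an odd prime and let $D_{2p}$ be the dihedral group of order $2p$. Then \[ \theta(D_{2p},d)= \begin{cases} 0 & \text{if } d=1;\\ p(p-2) & \text{if } d=2;\\ p-1 & \text{if } d=p;\\ 1 & \text{if } d=2p. \end{cases} \]
   Context: For a positive integer $n$, $D_{2n}=\langle a,b: a^{n}=b^{2}=(ba)^{2}=1\rangle$ is the dihedral group of order $2n$. For a finite group $G$ and a divisor $d$ of $|G|$, $\theta(G,d)$ is the number of automorphisms $f$ of $G$ such that $|\{g\in G: f(g)=g\}|=d$, i.e. the number of automorphisms of $G$ fixing exactly $d$ elements. *)

(* Defs.v *)
From HB Require Import structures.
From mathcomp Require Import all_boot all_fingroup all_solvable.
Set Implicit Arguments.
Unset Strict Implicit.
Unset Printing Implicit Defensive.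

(* Aut G consists of the permutations of gT supported in G that are
   multiplicative on G, so its elements correspond one-to-one to the
   automorphisms of G; fixed points are counted in G, not in gT. *)
Definition theta (gT : finGroupType) (G : {group gT}) (d : nat) : nat :=
  #|[set f in Aut G | #|[set g in G | f g == g]| == d]|.

(* Main.v *)
(* An automorphism of <x> ><| <y> is determined by the images (u, v) of (x, y),
   and every pair with u a nontrivial rotation and v a reflection occurs.
   If u = x, all rotations are fixed, and a reflection is fixed iff v = y.
   If u <> x, the only fixed rotation is 1; then s |-> s * (f s)^-1 is injective
   from the reflections to the rotations, hence onto, and its value 1 gives
   exactly one fixed reflection. *)
Require Import Defs.
From mathcomp Require Import all_boot all_fingroup all_solvable.

Local Open Scope nat_scope.

(** * Rotations and reflections *)

Section PrimeDihedral.

Local Open Scope group_scope.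

Variables (gT : finGroupType) (G : {group gT}) (p : nat) (x y : gT).
Hypotheses (p_prime : prime p) (p_odd : odd p).
Hypotheses (ox : #[x] = p) (oy : #[y] = 2) (xy : x ^ y = x^-1).
Hypothesis defG : <[x]> ><| <[y]> = G.

Let rotation_sub : <[x]> \subset G.
Proof. by case/sdprodP: defG => _ <- _ _; apply: mulG_subl. Qed.

Let rotation_in : {subset <[x]> <= G}.
Proof. exact/subsetP. Qed.

Let Gx : x \in G.
Proof. by rewrite -cycle_subG. Qed.

Let Gy : y \in G.
Proof.
by case/sdprodP: defG => _ <- _ _; rewrite (subsetP (mulG_subr _ _)) ?cycle_id.
Qed.

Let reflectionV s : s \in G :\: <[x]> -> s^-1 \in G :\: <[x]>.
Proof. by rewrite !inE !groupV. Qed.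

Let y_notin : y \notin <[x]>.
Proof.
case/sdprodP: defG => _ _ _ tiCY; apply/negP=> Cy.
have: y \in <[x]> :&: <[y]> by rewrite inE Cy cycle_id.
by rewrite tiCY inE -order_eq1 oy.
Qed.

Let cardG : #|G| = (2 * p)%N.
Proof. by rewrite -(sdprod_card defG) -!orderE ox oy mulnC. Qed.

Lemma card_reflections : #|G :\: <[x]>| = p.
Proof.
by rewrite cardsD (setIidPr rotation_sub) cardG -orderE ox mul2n -addnn addnK.
Qed.

Lemma conj_rotation_y c : c \in <[x]> -> c ^ y = c^-1.
Proof. by case/cycleP=> i ->; rewrite conjXg xy expgVn. Qed.

Lemma reflectionP s :
  reflect (exists2 c, c \in <[x]> & s = c * y) (s \in G :\: <[x]>).
Proof.
apply: (iffP idP) => [/setDP[Gs notCs] | [c Cc ->]]; last first.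
  by rewrite inE groupMl // y_notin groupM ?(rotation_in _ Cc).
case/sdprodP: defG => _ defCY _ _; move: Gs notCs; rewrite -defCY.
case/mulsgP=> c z Cc; rewrite cycle2g // !inE => /pred2P[]-> ->.
  by rewrite mulg1 Cc.
by exists c.
Qed.

(** Since [y] inverts rotations, [(c * y) ^+ 2 = c * c ^ y = 1]. *)
Lemma order_reflection s : s \in G :\: <[x]> -> #[s] = 2.
Proof.
case/setDP=> Gs notCs; have /reflectionP[c Cc defs]: s \in G :\: <[x]>.
  by rewrite inE notCs Gs.
apply: nt_prime_order => //; last first.
  by apply: contraNneq notCs => ->; rewrite group1.
have y1: y^-1 = y by apply/eqP; rewrite eq_invg_mul -expg2 -oy expg_order.
by rewrite defs expg2 -mulgA -{1}y1 -conjgE conj_rotation_y ?mulgV.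
Qed.

(** In [s = b * y] the rotation [b] commutes with [c], so only [y] acts. *)
Lemma conj_rotation_reflection c s :
  c \in <[x]> -> s \in G :\: <[x]> -> c ^ s = c^-1.
Proof.
move=> Cc /reflectionP[b Cb ->]; rewrite conjgM (conjgE c).
by rewrite (centsP (cycle_abelian x) c Cc b Cb) mulKg conj_rotation_y.
Qed.

(** As [p] is prime, a nontrivial rotation has order [p], the order of [<[x]>]. *)
Lemma rotation_generates c : c \in <[x]>^# -> <[c]> = <[x]>.
Proof.
case/setD1P=> c1 Cc; have cp: c ^+ p = 1.
  by apply/eqP; rewrite -order_dvdn -ox [#[x]]orderE order_dvdG.
apply/eqP; rewrite eqEcard cycle_subG Cc -!orderE ox.
by rewrite (nt_prime_order p_prime cp c1) leqnn.
Qed.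

Lemma mul_reflections s t :
  s \in G :\: <[x]> -> t \in G :\: <[x]> -> s * t \in <[x]>.
Proof.
(* Writing [t^-1], rather than [t], as [b * y] makes [y] cancel: [s * t = a * b^-1]. *)
case/reflectionP=> a Ca -> /reflectionV/reflectionP[b Cb defVt].
by rewrite -(invgK t) defVt invMg mulgA mulgK groupM ?groupV.
Qed.

(** * Automorphisms with prescribed images of the generators *)

(** The maps [x |-> u] and [y |-> v] glue along the semidirect product because [v], like [y],
    inverts every rotation. *)
Lemma exists_aut u v : u \in <[x]>^# -> v \in G :\: <[x]> ->
  exists2 f : {perm gT}, f \in Aut G & f x = u /\ f y = v.
Proof.
move=> Cu Rv; have genu := rotation_generates _ Cu.
have u_dvd: #[u] %| #[x] by rewrite !orderE genu.
have v_dvd: #[v] %| #[y] by rewrite order_reflection ?oy.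
have actf: {in <[x]> & <[y]>, morph_act 'J 'J (eltm u_dvd) (eltm v_dvd)}.
  have Cu_ i: u ^+ i \in <[x]> by rewrite -genu mem_cycle.
  move=> a b /cycleP[i ->]; rewrite cycle2g // !inE => /pred2P[]-> /=.
    by rewrite morph1 !conjg1.
  rewrite conj_rotation_y ?mem_cycle // morphV ?mem_cycle //= eltmE eltm_id.
  by rewrite conj_rotation_reflection.
pose h := sdprodm_morphism defG actf.
have imh: h @* G = G.
  rewrite im_sdprodm !im_eltm genu; apply/eqP.
  rewrite eqEsubset mul_subG ?cycle_subG //=; last by case/setDP: Rv.
  apply/subsetP=> g Gg; have [Cg | notCg] := boolP (g \in <[x]>).
    by rewrite -[g]mulg1 mem_mulg.
  have Rg: g \in G :\: <[x]> by rewrite inE notCg.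
  (* A reflection [g] is [(g * v^-1) * v], a rotation times [v]. *)
  by rewrite -[g](mulgKV v) mem_mulg ?cycle_id ?mul_reflections ?reflectionV.
(* A surjective endomorphism of a finite group is injective. *)
have injh: 'injm h by rewrite -card_im_injm imh.
exists (aut injh imh); first exact: Aut_aut.
split; rewrite autE //=; first by rewrite sdprodmEl ?cycle_id //= eltm_id.
by rewrite sdprodmEr ?cycle_id //= eltm_id.
Qed.

(** * Fixed points of a single automorphism *)

Section OneAutomorphism.

Variable f : {perm gT}.
Hypothesis Af : f \in Aut G.

Let fM : {in G &, {morph f : a b / a * b}}.
Proof. by move=> a b Ga Gb; rewrite -(autmE Af) morphM. Qed.

Let order_f g : g \in G -> #[f g] = #[g].
Proof. by move=> Gg; rewrite -(autmE Af) order_injm ?injm_autm. Qed.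

Let fX g i : g \in G -> f (g ^+ i) = f g ^+ i.
Proof. by move=> Gg; rewrite -(autmE Af) morphX. Qed.

(** Automorphisms preserve orders, and reflections have order 2 while [p] is odd. *)
Lemma aut_rotation : f x \in <[x]>^#.
Proof.
have ofx: #[f x] = p by rewrite order_f.
rewrite !inE -order_eq1 ofx; apply/andP; split.
  by rewrite neq_ltn prime_gt1 ?orbT.
apply: contraLR p_odd => notC; rewrite -ofx order_reflection //.
by rewrite inE notC (Aut_closed Af).
Qed.

(** If [f y] were a rotation, its order 2 would divide the odd [p]. *)
Lemma aut_reflection : f y \in G :\: <[x]>.
Proof.
rewrite inE (Aut_closed Af) // andbT; apply: contraL p_odd => Cfy.
by rewrite -dvdn2 -oy -(order_f _ Gy) -ox order_dvdG ?orderE.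
Qed.

Let im_rotation c : c \in <[x]> -> f c \in <[x]>.
Proof.
by case/cycleP=> i ->; rewrite fX // groupX //; case/setD1P: aut_rotation.
Qed.

Let im_reflection s : s \in G :\: <[x]> -> f s \in G :\: <[x]>.
Proof.
case/reflectionP=> c Cc ->; have Gc := rotation_in _ Cc.
have Cfc := im_rotation _ Cc; have := aut_reflection.
by rewrite fM // !inE (groupMl _ Cfc) (groupMl _ (rotation_in _ Cfc)).
Qed.

Let fixed := [set g in G | f g == g].

(** A nontrivial fixed rotation would generate [<[x]>], so [x] would be fixed too. *)
Lemma fixed_rotation_trivial c : f x != x -> c \in <[x]> -> f c = c -> c = 1.
Proof.
move=> fx Cc fc; apply: contraNeq fx => c1.
have Gc := rotation_in _ Cc.
have: x \in <[c]> by rewrite rotation_generates ?cycle_id // !inE c1.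
by case/cycleP=> i ->; rewrite fX // fc.
Qed.

Let shift s := s * (f s)^-1.

(** If the shifts of [s] and [t] agree, the rotation [t^-1 * s] is fixed by [f], hence trivial. *)
Lemma shift_inj : f x != x -> {in G :\: <[x]> &, injective shift}.
Proof.
move=> fx s t Rs Rt /= eq_st; have [/setDP[Gs _] /setDP[Gt _]] := (Rs, Rt).
apply/eqP; rewrite eq_sym eq_mulVg1; apply/eqP.
apply: fixed_rotation_trivial; rewrite ?mul_reflections ?reflectionV //.
rewrite fM ?groupV // -(autmE Af) morphV //= autmE.
(* Here [f s = (shift s)^-1 * s], in which [shift s] may be replaced by [shift t]. *)
rewrite -[f s](mulgKV s) -[f s * _]invgK invMg invgK -/(shift s) eq_st.
by rewrite /shift invMg invgK !mulgA mulVg mul1g.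
Qed.

Lemma card_fixed : #|fixed| =
  (if f x != x then 2 else if f y != y then p else 2 * p)%N.
Proof.
have fC: f x = x -> {in <[x]>, f =1 id}.
  by move=> fx _ /cycleP[i ->]; rewrite fX // fx.
case: eqVneq => [fx | fx] /=; last first.
  have sub1: shift @: (G :\: <[x]>) \subset <[x]>.
    apply/subsetP=> _ /imsetP[s Rs ->].
    by rewrite mul_reflections ?reflectionV ?im_reflection.
  (* Injectivity makes the image as large as [<[x]>]: both have [p] elements. *)
  have: 1 \in shift @: (G :\: <[x]>).
    suff ->: shift @: (G :\: <[x]>) = <[x]> by [].
    apply/eqP; rewrite eqEcard sub1 (card_in_imset (shift_inj fx)).
    by rewrite card_reflections -orderE ox leqnn.
  case/imsetP=> s Rs /esym s1; have [Gs notCs] := setDP Rs.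
  suff ->: fixed = [set 1; s].
    by rewrite cards2 (_ : 1 != s) //; apply: contraNneq notCs => <-; apply: group1.
  apply/setP=> g; rewrite !inE; apply/andP/pred2P => [[Gg /eqP fg]|]; last first.
    case=> ->; first by rewrite -(autmE Af) morph1.
    by split=> //; rewrite eq_sym eq_mulgV1; apply/eqP.
  have [Cg | notCg] := boolP (g \in <[x]>).
    by left; apply: fixed_rotation_trivial.
  (* Any fixed reflection has shift 1, as [s] does. *)
  right; apply: (shift_inj fx); rewrite // ?inE ?notCg //.
  by rewrite s1 /shift fg mulgV.
case: eqVneq => [fy | fy] /=.
  rewrite -cardG; apply: eq_card => g; rewrite inE andb_idr // => Gg.
  have [Cg | notCg] := boolP (g \in <[x]>); first by rewrite fC.
  have /reflectionP[c Cc ->]: g \in G :\: <[x]> by rewrite inE notCg.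
  by rewrite fM ?(rotation_in _ Cc) // fC // fy.
rewrite -ox orderE; apply: eq_card => g; rewrite inE.
have [Cg | notCg] := boolP (g \in <[x]>).
  by rewrite fC // eqxx rotation_in.
(* As [f] fixes rotations, [f (c * y) = c * f y]; fixing [c * y] would fix [y]. *)
apply: contraNF fy => /andP[Gg].
have /reflectionP[c Cc ->]: g \in G :\: <[x]> by rewrite inE notCg.
by rewrite fM ?(rotation_in _ Cc) // fC // (inj_eq (mulgI c)).
Qed.

End OneAutomorphism.

(** * Counting automorphisms through pairs of images *)

Lemma aut_inj : {in Aut G &, injective (fun f : {perm gT} => (f x, f y))}.
Proof.
move=> f h Af Ah /= [fhx fhy]; apply: (eq_Aut Af Ah) => g.
case/sdprodP: defG => _ <- _ _ /mulsgP[_ _ /cycleP[i ->] /cycleP[j ->] ->].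
rewrite -(autmE Af) -(autmE Ah) !(morphM, morphX) ?groupX //=.
by rewrite !autmE fhx fhy.
Qed.

(** The bijection [f |-> (f x, f y)] turns the count of automorphisms into one of pairs, with the
    number of fixed points read off from the pair. *)
Lemma theta_pairs d : theta G d =
  #|[set z in setX <[x]>^# (G :\: <[x]>) |
      (if z.1 != x then 2 else if z.2 != y then p else 2 * p)%N == d]|.
Proof.
rewrite /theta; set A := [set f in _ | _].
rewrite -(@card_in_imset _ _ (fun f : {perm gT} => (f x, f y)) A); last first.
  by move=> f h /setIdP[Af _] /setIdP[Ah _]; apply: aut_inj.
apply: eq_card => -[u v]; rewrite in_set in_setX /=.
apply/imsetP/andP => [[f /setIdP[Af fd] [-> ->]] | [/andP[Cu Rv] uvd]].
  move: fd; rewrite card_fixed // => ->.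
  by rewrite aut_rotation // aut_reflection.
have [||f Af [fx fy]] := exists_aut u v => //.
by exists f; rewrite ?fx ?fy // inE Af card_fixed // fx fy.
Qed.

Lemma theta_dihedral :
  [/\ theta G 1 = 0, theta G 2 = p * (p - 2), theta G p = p - 1
    & theta G (2 * p) = 1]%N.
Proof.
have p_gt2: (2 < p)%N by apply: odd_prime_gt2.
(* The values 2, [p] and [2 * p] are distinct and none is 1, so each [d] selects at most one
   branch. *)
have [p1 p2]: (p != 1 /\ p != 2)%N by rewrite !neq_ltn p_gt2 (ltnW p_gt2) !orbT.
have pp: (p != 2 * p)%N by rewrite neq_ltn ltn_Pmull ?prime_gt0.
have pp1: (2 * p != 1)%N by rewrite muln_eq1.
have pp2: (2 * p != 2)%N by rewrite -[X in _ != X](muln1 2) eqn_pmul2l.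
have x1: x != 1 by rewrite -order_eq1 ox.
have Ry: y \in G :\: <[x]> by rewrite inE y_notin.
have Cx: x \in <[x]>^# by rewrite !inE x1 cycle_id.
rewrite !theta_pairs; split.
- apply/eqP; rewrite cards_eq0; apply/eqP/setP=> z; rewrite !inE.
  by case: (z.1 != x); case: (z.2 != y); rewrite ?(negPf p1) ?(negPf pp1) andbF.
(* There are [p - 2] rotations other than 1 and [x], each paired with any of the [p] reflections. *)
- transitivity #|setX (<[x]>^# :\ x) (G :\: <[x]>)|.
    apply: eq_card => z; rewrite !inE.
    by case: (z.1 != x); case: (z.2 != y);
      rewrite ?(negPf p2) ?(negPf pp2) ?andbT ?andbF.
  rewrite cardsX card_reflections mulnC; congr (_ * _)%N.
  have := cardsD1 x <[x]>^#; have := cardsD1 1 <[x]>.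
  by rewrite Cx group1 -orderE ox => -> ->; rewrite !add1n subn2.
(* The first image is [x]; the second is any of the [p - 1] reflections other than [y]. *)
- transitivity #|setX [set x] ((G :\: <[x]>) :\ y)|.
    apply: eq_card => -[u v]; rewrite !inE /=.
    case: (eqVneq u x) => [-> | _]; rewrite ?(negPf x1) ?cycle_id /=.
      by case: (v != y); rewrite ?eqxx ?[(2 * p == p)%N]eq_sym ?(negPf pp) ?andbT ?andbF.
    by rewrite (eq_sym 2) (negPf p2) andbF.
  rewrite cardsX cards1 mul1n.
  by have := cardsD1 y (G :\: <[x]>); rewrite Ry card_reflections => ->; rewrite addKn.
- transitivity #|[set (x, y)]|; last by rewrite cards1.
  apply: eq_card => -[u v]; rewrite !inE /= xpair_eqE.
  case: (eqVneq u x) => [-> | _] /=; last by rewrite (eq_sym 2) (negPf pp2) andbF.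
  case: (eqVneq v y) => [-> | _] /=; last by rewrite (negPf pp) andbF.
  by move: Cx Ry; rewrite eqxx !inE => -> ->.
Qed.

End PrimeDihedral.

(** * Transfer to the library's dihedral group *)

Theorem theorem5p2 (p : nat) (p_prime : prime p) (p_odd : odd p) :
  [/\ theta 'D_(2 * p)%N 1 = 0,
      theta 'D_(2 * p)%N 2 = p * (p - 2),
      theta 'D_(2 * p)%N p = p - 1
    & theta 'D_(2 * p)%N (2 * p) = 1].
Proof.
have p_gt1 := prime_gt1 p_prime; set D := ('D_(2 * p)%N)%G.
have oD: #|D| = 2 * p by rewrite /D mul2n card_dihedral.
(* The presentation supplies generators [x], [y] of [D] satisfying the relations; at this stage
   their orders are only bounded above. *)
have: (D \homg Grp (x : y : x ^+ p, y ^+ 2, x ^ y = x^-1))%g.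
  by rewrite /D mul2n; apply: isoGrp_hom; apply: Grp_dihedral.
case/existsP=> -[x y] /= /eqP[defD xp y2 xy].
have nCY: <[y]>%g \subset 'N(<[x]>)%g by rewrite norms_cycle xy groupV cycle_id.
have defCY: (<[x]> * <[y]>)%g = D by rewrite -norm_joinEr.
have ox_le: #[x]%g <= p by rewrite dvdn_leq ?prime_gt0 // order_dvdn xp.
have oy_le: #[y]%g <= 2 by rewrite dvdn_leq // order_dvdn y2.
(* The product of [<[x]>] and [<[y]>] fills [D], of order [2 * p], which forces both order bounds to
   be attained. *)
have le_ord: 2 * p <= #[x]%g * #[y]%g.
  by rewrite !orderE mul_cardG defCY oD leq_pmulr ?cardG_gt0.
have oy: #[y]%g = 2.
  apply/eqP; rewrite eqn_leq oy_le ltnNge; apply: contraL le_ord => y1.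
  rewrite -ltnNge (leq_ltn_trans (leq_mul ox_le y1)) // muln1.
  by rewrite ltn_Pmull ?prime_gt0.
have ox: #[x]%g = p.
  apply/eqP; rewrite eqn_leq ox_le.
  by move: le_ord; rewrite oy (mulnC #[x]%g) leq_pmul2l.
have tiCY: (<[x]> :&: <[y]> = 1)%g by rewrite coprime_TIg // -!orderE ox oy coprimen2.
have sdD: (<[x]> ><| <[y]>)%g = D by rewrite sdprodE.
exact: theta_dihedral p_prime p_odd ox oy xy sdD.
Qed.
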